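(* Let $A\in\mathbb{R}^{n\times n}$ have distinct eigenvalues $\lambda_1,\dots,\lambda_p$ with geometric multiplicities $k_1,\dots,k_p$. The function $f:2^V\to\mathbb{R}$, $V=\{1,\dots,n\}$, $$f(S)=\sum_{i=1}^p\max_{h_i\in H_i}|S\cap h_i|,$$ is submodular on $S\subseteq V$. Consequently, the greedy algorithm based on $f$ (specified in the context) for the minimal actuated state controllability problem (MACP) achieves an $\mathcal{O}(\log(n))$-approximation, or more precisely, a $\log\left(\sum_{i=1}^pk_i\right)$-approximation.
   Context: $(A,B)$ controllable refers to the system $\dot x(t)=Ax(t)+Bu(t)$. For each (possibly complex) eigenvalue $\lambda_i$, $k_i=n-\mathrm{rank}(\lambda_iI-A)$, and $X_i\in\mathbb{C}^{n\times k_i}$ has linearly independent columns spanning the left null space of $\lambda_iI-A$ (so $X_i^{\intercal}(\lambda_iI-A)=0$). With $X_{iS}^{\intercal}$ the submatrix of $X_i^{\intercal}$ formed by the columns indexed by $S$, $H_i=\{\mathcal{J}\subseteq\{1,\dots,n\}:|\mathcal{J}|=k_i,\ X_{i\mathcal{J}}^{\intercal}\text{ has full row rank}\}$ (independent of the choice of $X_i$). One has $\max_{h_i\in H_i}|S\cap h_i|=\mathrm{rank}(X_{iS}^{\intercal})$. $f:2^V\to\mathbb{R}$ is submodular if for all $S_1\subseteq S_2\subseteq V$ and $s\in V\setminus S_2$, $f(S_1\cup\{s\})-f(S_1)\ge f(S_2\cup\{s\})-f(S_2)$. MACP: find $B\in\mathbb{R}^{n\times n}$ with the minimum number of nonzero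 rows such that $(A,B)$ is controllable; equivalently, find a smallest $S\subseteq\{1,\dots,n\}$ such that $(A,I_S)$ is controllable, where $I_S$ consists of the columns of the $n\times n$ identity matrix indexed by $S$. An algorithm achieves an $\alpha$-approximation for the MACP if it returns a set $S$ with $(A,I_S)$ controllable and $|S|$ at most $\alpha$ times the optimal value. Greedy algorithm: start with $S=\emptyset$; while $f(S)<\sum_{i=1}^pk_i$, choose $s\in\arg\max_{a\in V\setminus S}\,[f(S\cup\{a\})-f(S)]$ and replace $S$ by $S\cup\{s\}$; return $S$.
   Formalization: The log(Σk_i) ratio is proved with base-2 logarithm and only for Σk_i > 1 (it fails for Σk_i = 1, e.g. n = 1, A = 0; the natural log fails for A = diag(1,2)); for all Σk_i the ratio 1 + ln(Σk_i) is proved instead. *)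

(* Defs.v *)
From HB Require Import structures.
From mathcomp Require Import all_boot all_order all_algebra.
From mathcomp Require Import all_classical all_reals all_analysis.
From mathcomp Require Import complex.
Import Order.TTheory GRing.Theory Num.Theory.
Import numFieldNormedType.Exports.
Set Implicit Arguments.
Unset Strict Implicit.
Unset Printing Implicit Defensive.
Local Open Scope ring_scope.

Definition cplx_mx (R : rcfType) m n (A : 'M[R]_(m, n)) : 'M[R[i]]_(m, n) :=
  map_mx (real_complex R) A.

(* x'(t) = A x(t) + B u(t).  Any continuous input on [0, T] extends
   continuously to the whole line, and the state then exists for all times, so
   asking for u and x on all of R is no restriction. *)
Definition trajectory (R : realType) n m (A : 'M[R]_n) (B : 'M[R]_(n, m))
    (u : R -> 'cV[R]_m) (x : R -> 'cV[R]_n) : Prop :=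
  continuous u /\
  forall t : R, is_derive t (1 : R) x (A *m x t + B *m u t).

Definition controllable (R : realType) n m (A : 'M[R]_n) (B : 'M[R]_(n, m)) :
    Prop :=
  forall x0 x1 : 'cV[R]_n, exists T : R, 0 < T /\
    exists (u : R -> 'cV[R]_m) (x : R -> 'cV[R]_n),
      [/\ trajectory A B u x, x 0 = x0 & x T = x1].

Definition col_restrict (R : Type) m n (M : 'M[R]_(m, n)) (S : {set 'I_n}) :
    'M[R]_(m, #|S|) :=
  colsub (fun j : 'I_#|S| => enum_val j) M.

Definition id_cols (R : realType) n (S : {set 'I_n}) : 'M[R]_(n, #|S|) :=
  col_restrict 1%:M S.

Definition geom_mult (R : realType) n (A : 'M[R]_n) (z : R[i]) : nat :=
  (n - \rank (z%:M - cplx_mx A)%R)%N.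

Definition left_null_basis (R : realType) n (A : 'M[R]_n) (z : R[i])
    (X : 'M[R[i]]_(n, geom_mult A z)) : Prop :=
  row_free X^T /\ (X^T == kermx (z%:M - cplx_mx A)%R)%MS.

(* eigenvalue is the library's predicate, which refers to row eigenvectors; the
   spectrum is the same as for column eigenvectors. *)
Definition eigen_data (R : realType) n (A : 'M[R]_n) p (lam : 'I_p -> R[i])
    (X : forall i, 'M[R[i]]_(n, geom_mult A (lam i))) : Prop :=
  [/\ injective lam,
      forall z, eigenvalue (cplx_mx A) z <-> exists i, lam i = z
    & forall i, left_null_basis (X i)].

Definition basis_columns (F : fieldType) n k (X : 'M[F]_(n, k)) :
    {set {set 'I_n}} :=
  [set J : {set 'I_n} | (#|J| == k) && row_free (col_restrict X^T J)].

Definition act_fun (R : realType) n p (k : 'I_p -> nat)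
    (X : forall i, 'M[R[i]]_(n, k i)) (S : {set 'I_n}) : R :=
  \sum_(i < p) (\max_(h in basis_columns (X i)) #|S :&: h|)%:R.

Definition submodular (R : realType) (V : finType) (f : {set V} -> R) : Prop :=
  forall (S1 S2 : {set V}) (s : V), S1 \subset S2 -> s \notin S2 ->
    f (s |: S2) - f S2 <= f (s |: S1) - f S1.

Section Greedy.
Variables (R : realType) (V : finType) (f : {set V} -> R) (K : R).

Definition greedy_step (S S' : {set V}) : Prop :=
  f S < K /\ exists2 a, a \notin S &
    S' = a |: S /\
    forall b, b \notin S -> f (b |: S) - f S <= f (a |: S) - f S.

Inductive greedy_state : {set V} -> Prop :=
  | greedy_init : greedy_state finset.set0
  | greedy_next S S' : greedy_state S -> greedy_step S S' -> greedy_state S'.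

Definition greedy_returns (S : {set V}) : Prop := greedy_state S /\ K <= f S.

(* Every step enlarges S, so a run that never gets stuck terminates. *)
Definition greedy_never_stuck : Prop :=
  forall S, greedy_state S -> f S < K -> exists S', greedy_step S S'.
End Greedy.

Definition nonzero_rows (R : realType) n m (B : 'M[R]_(n, m)) : nat :=
  #|[set i | row i B != 0]|.

Definition macp_optimum (R : realType) n (A : 'M[R]_n) (k : nat) : Prop :=
  (exists2 B : 'M[R]_n, controllable A B & nonzero_rows B = k) /\
  (forall B : 'M[R]_n, controllable A B -> (k <= nonzero_rows B)%N).

Definition macp_approx (R : realType) n (A : 'M[R]_n) (alpha : R)
    (S : {set 'I_n}) : Prop :=
  controllable A (id_cols R S) /\
  exists2 k, macp_optimum A k & #|S|%:R <= alpha * k%:R.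

(* Total correctness, for every way of breaking ties in the arg max. *)
Definition greedy_achieves (R : realType) n (A : 'M[R]_n)
    (f : {set 'I_n} -> R) (K alpha : R) : Prop :=
  greedy_never_stuck f K /\
  forall S, greedy_returns f K S -> macp_approx A alpha S.

(* Main.v *)
Require Import Defs.
From mathcomp Require Import all_boot all_order all_algebra.
From mathcomp Require Import all_classical all_reals all_analysis.
From mathcomp Require Import complex ring lra zify.
Import Order.TTheory GRing.Theory Num.Theory.
Import numFieldNormedType.Exports.
Local Open Scope classical_set_scope.
Local Open Scope ring_scope.

(** For each eigenvalue, the largest overlap of S with a basis of the columns of
    X_i^T is the rank of those columns with index in S ([max_basis_columns]).
    Adding one index raises such a rank by 0 or 1, and by 0 as soon as the new
    column lies in the span of the old ones ([row_rank_submod]); hence f, a sum of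
    ranks, is submodular.

    The greedy bound needs f to measure controllability. By the
    Popov-Belevitch-Hautus test, (A, B) is controllable exactly when no left
    eigenvector of A is killed by B. If v A = z v and v B = 0, then the complex
    coordinate v x of the state ignores the input and cannot leave 0
    ([controllable_pbh]). Conversely the trajectories x = adj(D - A) B y and
    u = chi(D) y, with D = d/dt, chi the characteristic polynomial of A and y any
    vector of polynomials, steer any state to any other: the state at a time is
    a combination of the coefficients of adj(s - A) B weighted by derivatives of
    y, these coefficients span everything because their left annihilator is
    A-invariant and would otherwise contain an eigenvector killed by B, and the
    derivatives of y can be prescribed at two times ([pbh_controllable]). Since
    the left eigenvectors at lam i are the combinations of the rows of X_i^T, the
    test for B = I_S says that every X_iS^T has full row rank, that is
    f(S) = K = sum k_i ([pbh_id_cols]), and it implies the same for the set of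
    nonzero rows of any B passing it ([pbh_support]).

    What remains is set cover. If an optimal C has o elements and the gap is
    r = K - f(S), some element of C closes at least r/o of it ([greedy_gain]); a
    step that closes d >= r/o lowers the harmonic number H(r) by at least
    d/r >= 1/o. Therefore the greedy set has at most o H(K) elements
    ([greedy_card_harmonic]), and H(K) <= 1 + ln K. Moreover H(K) <= log_2 K for
    K > 4, while for K <= 4 the bounds #|S| <= K and the optimality of greedy when
    o = 1 give the binary logarithm too. Finally K <= n, so the ratio is
    O(log n). *)

Set Implicit Arguments.
Unset Strict Implicit.
Unset Printing Implicit Defensive.

(** * Ranks of sets of rows *)

Section RowRank.
Context {F : fieldType} {n k : nat}.
Implicit Types (X : 'M[F]_(n, k)) (S T J : {set 'I_n}).

Definition row_span X S : 'M[F]_k := (\sum_(i in S) <<row i X>>)%MS.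

Definition row_rank X S : nat := \rank (row_span X S).

Lemma mxrank_adds_row (U : 'M[F]_k) (v : 'rV[F]_k) :
  \rank (U + v)%MS = (\rank U + ~~ (v <= U)%MS)%N.
Proof.
have [vU|vU] := boolP (v <= U)%MS; first by rewrite addn0 (addsmx_idPl vU).
apply/eqP; rewrite eqn_leq; apply/andP; split.
  apply: leq_trans (mxrank_adds_leqif U v).1 _.
  by rewrite leq_add2l rank_leq_row.
rewrite addn1 (ltn_leqif (mxrank_leqif_sup (addsmxSl U v))).
by apply: contra vU; apply: submx_trans (addsmxSr _ _).
Qed.

Lemma row_spanS X S T : S \subset T -> (row_span X S <= row_span X T)%MS.
Proof.
move=> sST; apply/sumsmx_subP => i iS.
by apply: (sumsmx_sup i) => //; apply: (fintype.subsetP sST).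
Qed.

Lemma row_rankS X S T : S \subset T -> (row_rank X S <= row_rank X T)%N.
Proof. by move=> sST; apply/mxrankS/row_spanS. Qed.

Lemma row_rankU1 X S s : s \notin S ->
  row_rank X (s |: S) =
  (row_rank X S + ~~ (row s X <= row_span X S)%MS)%N.
Proof.
move=> sS; rewrite /row_rank /row_span finset.big_setU1 //= addsmxC.
by rewrite (adds_eqmx (eqmx_refl _) (genmxE _)) mxrank_adds_row.
Qed.

Lemma row_rank0 X : row_rank X finset.set0 = 0%N.
Proof. by rewrite /row_rank /row_span big_set0 mxrank0. Qed.

(** The new row adds 1 to the rank unless it lies in the span of the others, and
    the span of the rows in S lies in that of the rows in T. *)
Lemma row_rank_submod X S T s : S \subset T -> s \notin T ->
  (row_rank X (s |: T) + row_rank X S <= row_rank X (s |: S) + row_rank X T)%N.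
Proof.
move=> sST sT; have sS : s \notin S by apply: contra sT; apply: (fintype.subsetP sST).
rewrite !row_rankU1 // addnAC [leqRHS]addnAC [X in (_ <= X + _)%N]addnC leq_add2l.
have [sTs|] := boolP (row s X <= row_span X T)%MS; first by [].
move=> nT; have -> // : ~~ (row s X <= row_span X S)%MS.
by apply: contra nT => /submx_trans; apply; apply: row_spanS.
Qed.

Lemma row_rankU_card X S T : (row_rank X (S :|: T) <= row_rank X S + #|T|)%N.
Proof.
have [m] := ubnP #|T|; elim: m T => // m IH T cT.
have [->|[x xT]] := finset.set_0Vmem T; first by rewrite finset.setU0 leq_addr.
have cTx := finset.cardsD1 x T; rewrite xT in cTx.
rewrite -(finset.setD1K xT) finset.setUCA.
have {}IH : (row_rank X (S :|: T :\ x) <= row_rank X S + #|T :\ x|)%N.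
  by apply: IH; move: cT; rewrite cTx.
have [xST|xST] := boolP (x \in S :|: T :\ x).
  rewrite (finset.setUidPr _) ?finset.sub1set //.
  by apply: leq_trans IH _; rewrite leq_add2l subset_leq_card // finset.subsetUr.
rewrite row_rankU1 // finset.setD1K // cTx addnCA addnC.
by apply: leq_add => //; case: (_ <= _)%MS.
Qed.

Lemma row_rank_le_card X S : (row_rank X S <= #|S|)%N.
Proof.
by have := row_rankU_card X finset.set0 S; rewrite row_rank0 finset.set0U.
Qed.

Lemma row_rank_le_width X S : (row_rank X S <= k)%N.
Proof. exact: rank_leq_col. Qed.

(** The rows in J outside S contribute at most their number to the rank. *)
Lemma row_rank_indep_sub X S J :
  S \subset J -> row_rank X J = #|J| -> row_rank X S = #|S|.
Proof.
move=> sSJ indJ; apply/eqP; rewrite eqn_leq row_rank_le_card.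
have := row_rankU_card X S (J :\: S).
rewrite -{1}(finset.setIidPr sSJ) finset.setID indJ.
by rewrite -(cardsID S J) (finset.setIidPr sSJ) leq_add2r.
Qed.

(** A maximal independent set J between S and T spans the rows of T: a row
    outside the span could be added to J. *)
Lemma row_rank_indep_extend X S T : S \subset T -> row_rank X S = #|S| ->
  exists J : {set 'I_n}, [/\ S \subset J, J \subset T, row_rank X J = #|J|
    & row_rank X J = row_rank X T].
Proof.
move=> sST indS.
pose P J := [&& S \subset J, J \subset T & row_rank X J == #|J|].
have [|J /maxsetP[/and3P[sSJ sJT /eqP indJ] maxJ] _] := @maxset_exists _ P S.
  by rewrite /P subxx sST indS eqxx.
exists J; split => //; apply/eqP; rewrite eqn_leq row_rankS //.
apply/mxrankS/sumsmx_subP => i iT; rewrite genmxE.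
apply/negPn/negP => iJ.
have niJ : i \notin J.
  apply: contra iJ => iJ; apply: (sumsmx_sup i) => //; rewrite genmxE.
  exact: submx_refl.
have : i |: J = J.
  apply: maxJ (finset.subsetUr _ _); rewrite /P (fintype.subset_trans sSJ (finset.subsetUr _ _)).
  by rewrite finset.subUset finset.sub1set iT sJT row_rankU1 // iJ indJ cardsU1 niJ addnC eqxx.
by move/setP/(_ i); rewrite finset.setU11 (negPf niJ).
Qed.

Lemma rank_col_restrict X S : \rank (col_restrict X^T S) = row_rank X S.
Proof.
have -> : col_restrict X^T S = (rowsub (fun j : 'I_#|S| => enum_val j) X)^T.
  by apply/matrixP => i j; rewrite !mxE.
rewrite mxrank_tr; apply/eqP; rewrite eqn_leq; apply/andP; split; apply: mxrankS.
  apply/row_subP => i; apply: (sumsmx_sup (enum_val i)); first exact: enum_valP.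
  rewrite genmxE; have -> : row i (rowsub (fun j => enum_val j) X) = row (enum_val i) X.
    by apply/rowP => j; rewrite !mxE.
  exact: submx_refl.
apply/sumsmx_subP => i iS; rewrite genmxE.
have -> : row i X = row (enum_rank_in iS i) (rowsub (fun j : 'I_#|S| => enum_val j) X).
  by apply/rowP => j; rewrite !mxE enum_rankK_in.
exact: row_sub.
Qed.

Lemma row_rankT X : row_rank X [set: 'I_n] = \rank X.
Proof.
apply/eqP; rewrite eqn_leq; apply/andP; split; apply: mxrankS.
  by apply/sumsmx_subP => i _; rewrite genmxE row_sub.
by apply/row_subP => i; apply: (sumsmx_sup i); rewrite // genmxE submx_refl.
Qed.

(** The rank function of the row matroid is the largest overlap with a basis:
    an independent set of rows spanning those in S extends to a basis, and the
    trace of a basis on S is independent. *)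
Lemma max_basis_columns X S : row_free X^T ->
  (\max_(h in basis_columns X) #|S :&: h|)%N = row_rank X S.
Proof.
move=> freeX; have rX : \rank X = k by rewrite -mxrank_tr; apply/eqP.
apply/eqP; rewrite eqn_leq; apply/andP; split.
  apply/bigmax_leqP => J; rewrite inE /row_free rank_col_restrict.
  move=> /andP[/eqP cJ /eqP rJ]; rewrite -cJ in rJ.
  rewrite -(row_rank_indep_sub (finset.subsetIr S J) rJ).
  exact/row_rankS/finset.subsetIl.
have [||J0 [_ sJ0S ind0 r0]] := @row_rank_indep_extend X finset.set0 S.
- exact: finset.sub0set.
- by rewrite row_rank0 cards0.
have [J [sJ0J _ indJ rJ]] := row_rank_indep_extend (finset.subsetT J0) ind0.
rewrite row_rankT rX in rJ.
have JB : J \in basis_columns X.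
  by rewrite inE /row_free rank_col_restrict -indJ rJ !eqxx.
apply: leq_trans (leq_bigmax_cond _ JB).
by rewrite -r0 ind0 subset_leq_card // finset.subsetI sJ0S sJ0J.
Qed.

End RowRank.

(** * Harmonic numbers and logarithms *)

Section Harmonic.
Context {R : realType}.

Definition harmonic_number (m : nat) : R := \sum_(i < m) i.+1%:R^-1.

Lemma harmonic_numberS m :
  harmonic_number m.+1 = harmonic_number m + m.+1%:R^-1.
Proof. exact: big_ord_recr. Qed.

(** Each of the c terms dropped is at least 1/r. *)
Lemma harmonic_number_drop (r c : nat) : (c <= r)%N ->
  harmonic_number (r - c) + c%:R / r%:R <= harmonic_number r.
Proof.
elim: c => [|c IH] cr; first by rewrite subn0 mul0r addr0.
apply: le_trans (IH (ltnW cr)).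
have rc : (r - c = (r - c.+1).+1)%N by rewrite subnSK.
have r0 : (0 < r)%N by apply: leq_ltn_trans cr.
rewrite rc harmonic_numberS -addrA lerD2l.
rewrite (_ : c.+1%:R = c%:R + 1); last by rewrite natr1.
rewrite mulrDl [leLHS]addrC.
by rewrite lerD2r mul1r lef_pV2 ?posrE ?ltr0n // ler_nat -rc leq_subr.
Qed.

Lemma ln_step (m : nat) : (0 < m)%N ->
  m.+1%:R^-1 <= ln m.+1%:R - ln m%:R :> R.
Proof.
move=> m0; have m0' : (0 : R) < m%:R by rewrite ltr0n.
have mS : (0 : R) < m.+1%:R by rewrite ltr0n.
rewrite -opprB -ln_div ?posrE // lerNr.
have -> : (m%:R / m.+1%:R : R) = 1 + - m.+1%:R^-1.
  by rewrite -natr1; field; rewrite natr1 gt_eqF.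
by apply: le_ln1Dx; rewrite ltrN2 invf_lt1 // ltr1n.
Qed.

Lemma harmonic_number_le1ln (m : nat) : (0 < m)%N ->
  harmonic_number m <= 1 + ln m%:R.
Proof.
elim: m => // -[|m] IH _; first by rewrite /harmonic_number big_ord1 ln1 addr0 invr1.
rewrite harmonic_numberS; apply: le_trans (lerD (IH isT) (@ln_step m.+1 isT)) _.
by rewrite [X in _ + X]addrC addrA addrK.
Qed.

(** At b = 0 the logarithm has its default value 0. *)
Lemma harmonic_number_le1lnn (a b : nat) : (a <= b)%N ->
  harmonic_number a <= 1 + ln b%:R :> R.
Proof.
move=> ab; have [->|a0] := posnP a.
  rewrite /harmonic_number big_ord0 addr_ge0 //.
  have [->|b0] := posnP b; first by rewrite ln0.
  by rewrite ln_ge0 // ler1n.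
apply: le_trans (harmonic_number_le1ln a0) _.
by rewrite lerD2l ler_ln ?posrE ?ltr0n ?ler_nat // (leq_trans a0).
Qed.

Lemma ln2_gt0 : 0 < ln (2 : R). Proof. by rewrite ln_gt0 // ltr1n. Qed.

Lemma ln2_le1 : ln (2 : R) <= 1.
Proof. by have := @le_ln1Dx R 1; rewrite -natr1; apply; lra. Qed.

(** Since ln 2 <= 1, the binary logarithm grows between m and m+1 by at least
    the increment 1/(m+1) of the harmonic numbers; the induction starts at 5
    because the inequality fails at 1, 2, 3 and 4. *)
Lemma harmonic_number_le_log2 (m : nat) : (4 < m)%N ->
  harmonic_number m <= ln m%:R / ln 2.
Proof.
have l2 := ln2_gt0; have l1 := ln2_le1.
elim: m => // m IH; rewrite ltnS leq_eqVlt => /predU1P[<-|m4]; last first.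
  rewrite harmonic_numberS; have := IH m4; have := @ln_step m (ltn_trans (isT : 0 < 4)%N m4).
  set x := m.+1%:R^-1; set y := harmonic_number m; set z := ln m%:R; set w := ln _.
  move=> xwz; rewrite !ler_pdivlMr // mulrDl => yz.
  have x0 : 0 <= x by rewrite invr_ge0 ler0n.
  nra.
have h5 : harmonic_number 5 = 137 / 60.
  by rewrite !harmonic_numberS /harmonic_number big_ord0; field.
rewrite h5 ler_pdivlMr //.
(* 5^7 = 78125 exceeds 2^16, and 16/7 exceeds 137/60 *)
have : 16 * ln 2 <= 7 * ln (5 : R).
  rewrite ![_%:R * ln _]mulr_natl -!lnXn ?ltr0n //.
  by rewrite ler_ln ?posrE ?exprn_gt0 ?ltr0n //; lra.
lra.
Qed.

(** Replaces the harmonic bound where that bound exceeds the binary logarithm,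
    once an optimal set has at least two elements. *)
Lemma double_log2_ge (m : nat) : (1 < m <= 4)%N -> m%:R <= 2 * (ln m%:R / ln 2) :> R.
Proof.
have l2 := ln2_gt0; move=> /andP[m1 m4].
rewrite mulrA ler_pdivlMr //.
case: m m1 m4 => [|[|[|[|[|m]]]]] // _ _.
- rewrite ![_%:R * ln _]mulr_natl -!lnXn ?ltr0n //.
  by rewrite ler_ln ?posrE ?exprn_gt0 ?ltr0n //; lra.
- rewrite (_ : 4%:R = 2 ^+ 2 :> R) ?lnXn //; lra.
Qed.

End Harmonic.

(** * The greedy algorithm *)

Section Greedy.
Context {V : finType} (g : {set V} -> nat).
Context (g0 : g finset.set0 = 0%N).
Context (gS : forall S T : {set V}, S \subset T -> (g S <= g T)%N).
Context (g_submod : forall (S T : {set V}) s, S \subset T -> s \notin T ->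
  (g (s |: T) + g S <= g (s |: S) + g T)%N).

Let K := g finset.setT.

Section Cover.
Context (C : {set V}) (gC : g C = K).

(** Some element of C closes at least a 1/#|C| part of the gap, because the
    gains of the elements of C, added to S one at a time, are at most their gains
    on S itself. *)
Lemma greedy_gain (S : {set V}) (d : nat) :
  (forall b, b \notin S -> (g (b |: S) <= g S + d)%N) ->
  (K - g S <= #|C| * d)%N.
Proof.
move=> gain; rewrite leq_subLR -gC.
suff : forall T : {set V}, (g (S :|: T) <= g S + #|T| * d)%N.
  by move/(_ C); apply: leq_trans; apply/gS/finset.subsetUr.
move=> T; have [m] := ubnP #|T|; elim: m T => // m IH T cT.
have [->|[x xT]] := finset.set_0Vmem T; first by rewrite finset.setU0 leq_addr.
have cTx := finset.cardsD1 x T; rewrite xT in cTx.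
rewrite -(finset.setD1K xT) finset.setUCA.
have {}IH : (g (S :|: T :\ x) <= g S + #|T :\ x| * d)%N.
  by apply: IH; move: cT; rewrite cTx.
rewrite finset.setD1K // cTx.
have [xST|xST] := boolP (x \in S :|: T :\ x).
  rewrite (finset.setUidPr _) ?finset.sub1set //.
  by apply: leq_trans IH _; lia.
have xS : x \notin S by apply: contra xST; rewrite finset.in_setU => ->.
have := g_submod (finset.subsetUl S (T :\ x)) xST; have := gain x xS.
by move: IH; lia.
Qed.

End Cover.

Section Run.
Context {R : realType}.
Notation state := (greedy_state (fun S => (g S)%:R : R) K%:R).
Notation step := (greedy_step (fun S => (g S)%:R : R) K%:R).

Lemma greedy_stepP S S' : step S S' -> exists a, [/\ (g S < K)%N, a \notin S,
  S' = a |: S & forall b, b \notin S -> (g (b |: S) <= g (a |: S))%N].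
Proof.
case; rewrite ltr_nat => gK [a aS [-> amax]]; exists a; split => // b bS.
by have := amax b bS; rewrite lerD2r ler_nat.
Qed.

Lemma greedy_never_stuck_nat : greedy_never_stuck (fun S => (g S)%:R : R) K%:R.
Proof.
move=> S _; rewrite ltr_nat => gK.
have [b0 b0S] : exists b, b \notin S.
  apply/existsP; rewrite -negb_forall; apply: contraL gK => /forallP allS.
  have -> : S = finset.setT by apply/finset.setP => x; rewrite allS finset.in_setT.
  by rewrite ltnn.
pose a := [arg max_(a > b0 | a \notin S) g (a |: S)]%N.
exists (a |: S); split; first by rewrite ltr_nat.
rewrite /a; case: arg_maxnP => // c cS cmax; exists c => //; split => // b bS.
by rewrite lerD2r ler_nat; apply: cmax.
Qed.

(** Applied to the cover by all of V, the gain bound excludes a useless best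
    element while a gap remains. *)
Lemma greedy_gain_pos S S' : step S S' -> (g S < g S')%N.
Proof.
move=> /greedy_stepP[a [gK aS -> amax]].
have := @greedy_gain finset.setT erefl S (g (a |: S) - g S)%N.
have : (g S <= g (a |: S))%N by apply/gS/finset.subsetUr.
move=> ga; rewrite subnKC //; move/(_ amax).
by move: gK ga; nia.
Qed.

Lemma greedy_card_le S : state S -> (#|S| <= g S)%N.
Proof.
elim=> [|T T' _ IH stepT]; first by rewrite finset.cards0.
have := greedy_gain_pos stepT; case/greedy_stepP: stepT => a [_ aT -> _].
by rewrite finset.cardsU1 aT; apply: leq_ltn_trans.
Qed.

(** With #|C| <= 1 the gain bound says that the first step closes the whole gap. *)
Lemma greedy_cover1 C S : g C = K -> (#|C| <= 1)%N -> state S -> (#|S| <= 1)%N.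
Proof.
move=> gC C1 stS; suff [->|[]] : S = finset.set0 \/ (#|S| <= 1)%N /\ (K <= g S)%N.
- by rewrite finset.cards0.
- by [].
elim: stS => [|T T' _ IH stepT]; first by left.
right; case/greedy_stepP: stepT => a [gT aT -> amax].
case: IH gT => [T0 gT|[_]]; last by lia.
have ga : (g T <= g (a |: T))%N by apply/gS/finset.subsetUr.
have := @greedy_gain C gC T (g (a |: T) - g T)%N.
rewrite subnKC // => /(_ amax); rewrite finset.cardsU1 aT T0 finset.cards0 g0.
by move: ga; rewrite T0 g0; nia.
Qed.

(** With r the gap left and d the gain of a step, r <= #|C| d, and the harmonic
    number of the gap drops by at least d/r >= 1/#|C|, which pays for the new
    element. *)
Lemma greedy_card_harmonic C S : g C = K -> state S ->
  #|S|%:R + #|C|%:R * harmonic_number (K - g S)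
    <= #|C|%:R * harmonic_number K :> R.
Proof.
move=> gC; elim=> [|T T' _ IH stepT]; first by rewrite finset.cards0 g0 subn0 add0r.
apply: le_trans IH; have gT' := greedy_gain_pos stepT.
case/greedy_stepP: stepT => a [gT aT eT' amax]; rewrite eT' in gT' *.
have aK : (g (a |: T) <= K)%N by apply/gS/finset.subsetT.
set d := (g (a |: T) - g T)%N.
have := @greedy_gain C gC T d; rewrite subnKC // => [|]; last exact: ltnW.
move=> /(_ amax) gap.
have -> : (K - g (a |: T) = (K - g T) - d)%N by rewrite /d; lia.
have dr : (d <= K - g T)%N by rewrite /d; lia.
have r0 : (0 < K - g T)%N by rewrite subn_gt0.
have drop := @harmonic_number_drop R _ _ dr.
have step1 : 1 <= #|C|%:R * (d%:R / (K - g T)%N%:R) :> R.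
  by rewrite mulrA ler_pdivlMr ?ltr0n // mul1r -natrM ler_nat.
rewrite finset.cardsU1 aT -[nat_of_bool _]/1%N natrD.
have C0 : 0 <= #|C|%:R :> R by rewrite ler0n.
have := ler_wpM2l C0 drop; rewrite mulrDr.
move: step1; set u := _ * (_ / _); set v := _ * harmonic_number _.
set w := _ * harmonic_number _; lra.
Qed.

End Run.
End Greedy.

(** * Necessity of the eigenvector test *)

Section PBH.
Context {R : realType}.

(** The Popov-Belevitch-Hautus eigenvector test: B kills no left eigenvector of
    A, complex ones included. *)
Definition pbh n m (A : 'M[R]_n) (B : 'M[R]_(n, m)) : Prop :=
  forall (z : R[i]) (v : 'rV[R[i]]_n),
    v *m cplx_mx A = z *: v -> v *m cplx_mx B = 0 -> v = 0.

Lemma is_derive_mxP m n (f : R -> 'M[R]_(m, n)) (d : 'M[R]_(m, n)) (t : R) :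
  is_derive t (1 : R) f d <->
  forall i j, is_derive t (1 : R) (fun s => f s i j) (d i j).
Proof.
split=> [[fd <-] i j|fd].
  have fdij := (derivable_mxP f t 1).1 fd i j.
  by apply: DeriveDef => //; rewrite derive_mx // mxE.
have fder : derivable f t 1.
  by apply/derivable_mxP => i j; have [] := fd i j.
apply: DeriveDef => //; rewrite derive_mx //; apply/matrixP => i j.
by rewrite mxE; have [] := fd i j.
Qed.

Lemma is_derive_mulmx m n p (M : 'M[R]_(m, n)) (f : R -> 'M[R]_(n, p)) d (t : R) :
  is_derive t (1 : R) f d -> is_derive t (1 : R) (fun s => M *m f s) (M *m d).
Proof.
move=> /is_derive_mxP fd; apply/is_derive_mxP => i j.
have -> : (fun s => (M *m f s) i j) = \sum_k (fun s => M i k * f s k j).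
  by apply/funext => s; rewrite mxE fct_sumE.
rewrite mxE; exact: is_derive_sum.
Qed.

Lemma map_Re_mulmx n m (v : 'rV[R[i]]_n) (M : 'M[R]_(n, m)) :
  map_mx (@complex.Re R) (v *m cplx_mx M) = map_mx (@complex.Re R) v *m M.
Proof.
apply/rowP => j; rewrite !mxE (raddf_sum (@complex.Re R : Rcomplex R -> R)).
apply: eq_bigr => k _; rewrite !mxE; case: (v 0 k) => a b /=.
by rewrite mulr0 subr0.
Qed.

Lemma map_Im_mulmx n m (v : 'rV[R[i]]_n) (M : 'M[R]_(n, m)) :
  map_mx (@complex.Im R) (v *m cplx_mx M) = map_mx (@complex.Im R) v *m M.
Proof.
apply/rowP => j; rewrite !mxE (raddf_sum (@complex.Im R : Rcomplex R -> R)).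
apply: eq_bigr => k _; rewrite !mxE; case: (v 0 k) => a b /=.
by rewrite mulr0 add0r.
Qed.

(** The planar system u' = al u - be w, w' = be u + al w has the first integral
    (u^2 + w^2) exp (-2 al t), so it stays at the origin. *)
Lemma planar_rest (al be : R) (u w : R -> R) :
  (forall t, is_derive t (1 : R) u (al * u t - be * w t)) ->
  (forall t, is_derive t (1 : R) w (be * u t + al * w t)) ->
  u 0 = 0 -> w 0 = 0 -> forall t, u t = 0 /\ w t = 0.
Proof.
move=> du dw u0 w0 t.
pose E s := (u s * u s + w s * w s) * expR (- 2 * al * s).
have dE (s : R) : is_derive s (1 : R) E 0.
  have de : is_derive s (1 : R) (fun s => expR (- 2 * al * s)) (expR (- 2 * al * s) * (- 2 * al)).
    apply: (is_derive1_comp (f := expR) (g := fun s => - 2 * al * s)).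
    by apply: (is_derive_eq (is_deriveZ (- 2 * al) (is_derive_id s (1 : R)))); rewrite scaler1.
  have dq := is_deriveD (is_deriveM (du s) (du s)) (is_deriveM (dw s) (dw s)).
  apply: (is_derive_eq (is_deriveM dq de)).
  by rewrite !fctE /GRing.scale /=; ring.
have := is_derive_0_is_cst t 0 dE; rewrite /E u0 w0 mulr0 addr0 mul0r.
move/eqP; rewrite mulf_eq0 (gt_eqF (expR_gt0 _)) orbF -!expr2 paddr_eq0 ?sqr_ge0 //.
by rewrite !sqrf_eq0 => /andP[/eqP-> /eqP->].
Qed.

(** A left eigenvector killed by B gives a complex coordinate of the state on
    which the input has no influence; started at the origin it stays there. *)
Lemma controllable_pbh n m (A : 'M[R]_n) (B : 'M[R]_(n, m)) :
  controllable A B -> pbh A B.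
Proof.
move=> ctrl [al be] v vA vB.
pose a := map_mx (@complex.Re R) v; pose b := map_mx (@complex.Im R) v.
have aB : a *m B = 0.
  by rewrite -map_Re_mulmx vB; apply/rowP => j; rewrite !mxE.
have bB : b *m B = 0.
  by rewrite -map_Im_mulmx vB; apply/rowP => j; rewrite !mxE.
have aA : a *m A = al *: a - be *: b.
  by rewrite -map_Re_mulmx vA; apply/rowP => j; rewrite !mxE; case: (v 0 j).
have bA : b *m A = be *: a + al *: b.
  rewrite -map_Im_mulmx vA; apply/rowP => j; rewrite !mxE.
  by case: (v 0 j) => x y /=; rewrite addrC.
have rest (x1 : 'cV[R]_n) : (a *m x1) 0 0 = 0 /\ (b *m x1) 0 0 = 0.
  have [T [_ [u [x [[_ dx] x0 <-]]]]] := ctrl 0 x1.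
  apply: (planar_rest (al := al) (be := be) (u := fun t => (a *m x t) 0 0)
    (w := fun t => (b *m x t) 0 0)); rewrite ?x0 ?mulmx0 ?mxE // => t.
  - have := (is_derive_mxP _ _ _).1 (is_derive_mulmx a (dx t)) 0 0.
    rewrite mulmxDr !mulmxA aB mul0mx addr0 aA mulmxBl -!scalemxAl.
    by rewrite mxE [X in _ + X]mxE !mxE.
  - have := (is_derive_mxP _ _ _).1 (is_derive_mulmx b (dx t)) 0 0.
    rewrite mulmxDr !mulmxA bB mul0mx addr0 bA mulmxDl -!scalemxAl.
    by rewrite mxE !mxE.
apply/rowP => j; have [] := rest (delta_mx j 0).
by rewrite -!colE !mxE; case: (v 0 j) => x y /= -> ->.
Qed.

End PBH.

(** * Interpolation and sufficiency of the eigenvector test *)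

Section Hermite.
Context {R : realType}.
Implicit Types (p q : {poly R}) (a : R).

Lemma deriv_XsubC_mul a q k : (('X - a%:P) ^+ k.+1 * q)^`() =
  ('X - a%:P) ^+ k * (k.+1%:R *: q + ('X - a%:P) * q^`()).
Proof.
rewrite derivM deriv_exp derivXsubC mul1r /= mulrDr mulrA -exprSr.
by rewrite scaler_nat mulrnAl mulrnAr.
Qed.

Lemma derivn_XsubC_mul_lt a q k l : (l < k)%N ->
  ((('X - a%:P) ^+ k * q)^`(l)).[a] = 0.
Proof.
elim: l k q => [|l IH] [|k] q // lk.
  by rewrite derivn0 exprS !hornerE subrr !mul0r.
by rewrite derivSn deriv_XsubC_mul IH.
Qed.

Lemma derivn_XsubC_mul a q k :
  ((('X - a%:P) ^+ k * q)^`(k)).[a] = k`!%:R * q.[a].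
Proof.
elim: k q => [|k IH] q; first by rewrite expr0 mul1r fact0 mul1r.
rewrite derivSn deriv_XsubC_mul IH !hornerE subrr mul0r addr0.
by rewrite mulrA factS mulnC natrM.
Qed.

(** Newton interpolation: the term added at stage n has zeros of order n at both
    nodes, so it changes the n-th derivatives there and no lower ones. *)
Lemma hermite_interpolation (n : nat) (w0 w1 : nat -> R) :
  exists p : {poly R}, forall l, (l < n)%N ->
    p^`(l).[0] = w0 l /\ p^`(l).[1] = w1 l.
Proof.
elim: n => [|n [p IH]]; first by exists 0.
(* The added term has n-th derivatives n! (-1)^n c0 at 0 and n! c1 at 1. *)
pose c0 := (w0 n - p^`(n).[0]) / n`!%:R / (-1) ^+ n.
pose c1 := (w1 n - p^`(n).[1]) / n`!%:R.
pose r : {poly R} := c0%:P + (c1 - c0) *: 'X.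
have fact_nz : n`!%:R != 0 :> R by rewrite pnatr_eq0 -lt0n fact_gt0.
exists (p + 'X^n * ('X - 1%:P) ^+ n * r) => l.
have at0 : 'X^n * ('X - 1%:P) ^+ n * r = ('X - 0%:P) ^+ n * (('X - 1%:P) ^+ n * r).
  by rewrite subr0 mulrA.
have at1 : 'X^n * ('X - 1%:P) ^+ n * r = ('X - 1%:P) ^+ n * ('X^n * r).
  by rewrite mulrCA mulrA.
rewrite ltnS leq_eqVlt => /predU1P[->|ln]; rewrite derivnD !hornerD.
- rewrite {1}at0 at1 !derivn_XsubC_mul !hornerE /=; split; rewrite /c0 /c1.
    by field; rewrite fact_nz signr_eq0.
  by rewrite expr1n; field; rewrite fact_nz signr_eq0.
- by rewrite {1}at0 at1 !derivn_XsubC_mul_lt // !addr0; apply: IH.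
Qed.

End Hermite.

Section Flat.
Context {R : realType}.

Definition eval_mx m n (P : 'M[{poly R}]_(m, n)) (t : R) : 'M[R]_(m, n) :=
  map_mx (fun p => p.[t]) P.

Lemma is_derive_eval_mx m n (P : 'M[{poly R}]_(m, n)) (t : R) :
  is_derive t (1 : R) (eval_mx P) (eval_mx (map_mx (@deriv R) P) t).
Proof.
apply/is_derive_mxP => i j.
have -> : (fun s => eval_mx P s i j) = horner (P i j).
  by apply/funext => s; rewrite mxE.
by rewrite !mxE; apply: is_derive_poly.
Qed.

Lemma eval_mx_mulC m n p (M : 'M[R]_(m, n)) (P : 'M[{poly R}]_(n, p)) t :
  eval_mx (map_mx polyC M *m P) t = M *m eval_mx P t.
Proof.
apply/matrixP => i j; rewrite !mxE horner_sum; apply: eq_bigr => k _.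
by rewrite !mxE hornerE.
Qed.

Lemma eval_mxD m n (P Q : 'M[{poly R}]_(m, n)) t :
  eval_mx (P + Q) t = eval_mx P t + eval_mx Q t.
Proof. by apply/matrixP => i j; rewrite !mxE hornerD. Qed.

Lemma eval_mx_trajectory n m (A : 'M[R]_n) (B : 'M[R]_(n, m))
    (X : 'M[{poly R}]_(n, 1)) (U : 'M[{poly R}]_(m, 1)) :
  map_mx (@deriv R) X = map_mx polyC A *m X + map_mx polyC B *m U ->
  trajectory A B (eval_mx U) (eval_mx X).
Proof.
move=> dX; split=> [t|t].
  apply/differentiable_continuous/derivable1_diffP.
  by have [] := is_derive_eval_mx U t.
by have := is_derive_eval_mx X t; rewrite dX eval_mxD !eval_mx_mulC.
Qed.

(** The C l are the coefficients of the polynomial matrix adj(s - A) B and chi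
    those of the characteristic polynomial; comparing powers of s in
    (s - A) adj(s - A) B = chi(s) B gives these relations. *)
Lemma adjugate_coefficients n m (A : 'M[R]_n) (B : 'M[R]_(n, m)) :
  exists (chi : nat -> R) (C : nat -> 'M[R]_(n, m)),
  [/\ chi n = 1, C n = 0, A *m C 0%N + chi 0%N *: B = 0
    & forall l, (l < n)%N -> C l = A *m C l.+1 + chi l.+1 *: B].
Proof.
case: n A B => [|n] A B.
  exists (fun=> 1), (fun=> 0); split => //; by apply/matrixP => [[]].
pose chi l := (char_poly A)`_l.
pose C l := (\sum_(i < n.+1 - l) chi (l.+1 + i)%N *: A ^+ i) *m B.
exists chi, C; split.
- by have := char_poly_monic A; rewrite monicE lead_coefE size_char_poly => /eqP.
- by rewrite /C subnn big_ord0 mul0mx.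
- rewrite /C mulmxA subn0 -[B in _ + chi _ *: B]mul1mx scalemxAl -mulmxDl.
  rewrite [X in X *m _](_ : _ = horner_mx A (char_poly A)).
    by rewrite Cayley_Hamilton mul0mx.
  have -> : horner_mx A (char_poly A) = \sum_(i < n.+2) chi i *: A ^+ i.
    rewrite -[in LHS](coefK (char_poly A)) poly_def raddf_sum size_char_poly.
    by apply: eq_bigr => i _; rewrite /= horner_mxZ rmorphXn /= horner_mx_X.
  rewrite [RHS]big_ord_recl addrC expr0; congr (_ + _).
  rewrite mulmx_sumr; apply: eq_bigr => i _.
  by rewrite -scalemxAr mulmxE -exprS.
- move=> l ln; rewrite /C mulmxA -[B in _ + chi _ *: B]mul1mx scalemxAl -mulmxDl.
  congr (_ *m B); rewrite subSS subSn // big_ord_recl addrC addn0 expr0; congr (_ + _).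
  rewrite mulmx_sumr; apply: eq_bigr => i _.
  by rewrite -scalemxAr mulmxE -exprS /= /bump leq0n add1n addnS.
Qed.

Lemma stable_subspace_eigenvector (C : numClosedFieldType) n (A N : 'M[C]_n) :
  (N *m A <= N)%MS -> N != 0 ->
  exists z (v : 'rV_n), [/\ v != 0, (v <= N)%MS & v *m A = z *: v].
Proof.
move=> stN N0.
have : (row_base N *m A <= row_base N)%MS.
  by rewrite (eqmxMr _ (eq_row_base N)) eq_row_base.
move=> /submxP[D eD].
have [|z /eigenvalueP[w wD w0]] := @eigenvalue_closed C _ D.
  by rewrite lt0n mxrank_eq0.
exists z, (w *m row_base N); split.
- by rewrite -[0](mul0mx _ (row_base N)) (inj_eq (row_free_inj (row_base_free N))).
- by rewrite -(eq_row_base N) submxMl.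
- by rewrite -mulmxA eD mulmxA wD scalemxAl.
Qed.

(** The common left annihilator of the C l is invariant under A and killed by
    B = C (n-1), so if it were nonzero it would contain an eigenvector of A
    contradicting the eigenvector test. *)
Lemma pbh_annihilator0 n m (A : 'M[R]_n) (B : 'M[R]_(n, m)) (chi : nat -> R)
    (C : nat -> 'M[R]_(n, m)) :
  chi n = 1 -> C n = 0 -> A *m C 0%N + chi 0%N *: B = 0 ->
  (forall l, (l < n)%N -> C l = A *m C l.+1 + chi l.+1 *: B) ->
  pbh A B ->
  forall v : 'rV[R[i]]_n, (forall l : 'I_n, v *m cplx_mx (C l) = 0) -> v = 0.
Proof.
move=> chin Cn C0 CS AB.
have killB k (V : 'M[R[i]]_(k, n)) :
    (forall l : 'I_n, V *m cplx_mx (C l) = 0) -> V *m cplx_mx B = 0.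
  case: n A B C chi V chin Cn CS {C0 AB} => [|n] A B C chi V chin Cn CS VC.
    by rewrite [V]thinmx0 mul0mx.
  by have := VC ord_max; rewrite CS //= Cn mulmx0 add0r chin scale1r.
have stab k (V : 'M[R[i]]_(k, n)) : (forall l : 'I_n, V *m cplx_mx (C l) = 0) ->
    forall l : 'I_n, V *m cplx_mx A *m cplx_mx (C l) = 0.
  move=> VC [l ln] /=; rewrite -mulmxA -map_mxM /=.
  have -> : A *m C l = (if l is l'.+1 then C l' else 0) - chi l *: B.
    case: l ln => [|l] ln; first by rewrite sub0r; apply/eqP; rewrite -addr_eq0 C0.
    by rewrite [C l]CS ?addrK // ltnW.
  rewrite map_mxB map_mxZ mulmxBr -scalemxAr killB // scaler0 subr0.
  case: l ln => [|l] ln; first by rewrite map_mx0 mulmx0.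
  exact: (VC (Ordinal (ltnW ln))).
pose N := (\bigcap_(l < n) kermx (cplx_mx (C l)))%MS.
have inN k (V : 'M[R[i]]_(k, n)) :
    (V <= N)%MS <-> (forall l : 'I_n, V *m cplx_mx (C l) = 0).
  split=> [/sub_bigcapmxP VN l|VC]; first by apply/sub_kermxP/VN.
  by apply/sub_bigcapmxP => l _; apply/sub_kermxP/VC.
have N0 : N = 0.
  apply/eqP/negPn/negP => nzN.
  have stN : (N *m cplx_mx A <= N)%MS by apply/inN/stab/inN/submx_refl.
  have [z [v [/eqP v0 vN vA]]] := stable_subspace_eigenvector stN nzN.
  by apply: v0; apply: AB vA _; apply/killB/inN.
by move=> v /inN; rewrite N0 => /submx0null.
Qed.

(** The columns of the C l are a triangular recombination of those of the A^l B,
    so this is the controllability criterion of Kalman. *)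
Lemma pbh_spans n m (A : 'M[R]_n) (B : 'M[R]_(n, m)) (chi : nat -> R)
    (C : nat -> 'M[R]_(n, m)) :
  chi n = 1 -> C n = 0 -> A *m C 0%N + chi 0%N *: B = 0 ->
  (forall l, (l < n)%N -> C l = A *m C l.+1 + chi l.+1 *: B) ->
  pbh A B ->
  forall x : 'cV[R]_n, exists w : 'I_n -> 'cV[R]_m, x = \sum_(l < n) C l *m w l.
Proof.
move=> chin Cn C0 CS AB x.
have ann0 := pbh_annihilator0 chin Cn C0 CS AB.
pose M := (\sum_(l < n) <<(C l)^T>>)%MS.
have fullM : row_full M.
  rewrite /row_full -mxrank_tr; change (row_free M^T).
  rewrite -kermx_eq0; apply/rowV0P => v /sub_kermxP vM.
  apply: (map_mx_inj (f := real_complex R)); rewrite map_mx0; apply: ann0 => l.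
  have /submxP[D eD] : ((C l)^T <= M)%MS.
    by apply: (sumsmx_sup l); rewrite // genmxE submx_refl.
  by rewrite -map_mxM /= -[C l]trmxK eD trmx_mul mulmxA vM mul0mx map_mx0.
have /sub_sumsmxP[u eu] : (x^T <= M)%MS by apply: submx_full.
have cl (l : 'I_n) : exists wl : 'cV_m, u l *m <<(C l)^T>>%MS = (C l *m wl)^T.
  have /submxP[d ed] : (u l *m <<(C l)^T>> <= (C l)^T)%MS.
    by apply: submx_trans (submxMl _ _) _; rewrite genmxE submx_refl.
  by exists d^T; rewrite ed trmx_mul trmxK.
have [w ew] := choice cl.
exists w; rewrite -[x]trmxK eu raddf_sum /=.
by apply: eq_bigr => l _; rewrite ew trmxK.
Qed.

(** The system is differentially flat. With D = d/dt, any smooth y : R -> R^m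
    yields the trajectory x = adj(D - A) B y, u = chi(D) y, and the state x(t) is
    the combination of the C l with weights the derivatives of y at t. These
    weights are free at the two times 0 and 1, by Hermite interpolation. *)
Lemma pbh_controllable n m (A : 'M[R]_n) (B : 'M[R]_(n, m)) :
  pbh A B -> controllable A B.
Proof.
move=> AB x0 x1.
have [chi [C [chin Cn C0 CS]]] := adjugate_coefficients A B.
have spans := pbh_spans chin Cn C0 CS AB.
have [w0 e0] := spans x0; have [w1 e1] := spans x1.
pose W (w : 'I_n -> 'cV[R]_m) j (l : nat) : R :=
  if insub l is Some i then w i j 0 else 0.
pose y j := sval (cid (hermite_interpolation n (W w0 j) (W w1 j))).
have yE (l : 'I_n) (j : 'I_m) : (y j)^`(l).[0] = w0 l j 0 /\ (y j)^`(l).[1] = w1 l j 0.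
  rewrite /y; case: cid => p /= /(_ l (ltn_ord l)) [-> ->].
  by rewrite /W insubT // => lt_l; rewrite (_ : Sub _ _ = l) //; apply: val_inj.
pose Y (l : nat) : 'M[{poly R}]_(m, 1) := \col_j (y j)^`(l).
have dY l : map_mx (@deriv R) (Y l) = Y l.+1.
  by apply/matrixP => i j; rewrite !mxE derivnS.
pose X := \sum_(l < n) map_mx polyC (C l) *m Y l.
pose U := \sum_(l < n.+1) (chi l)%:P *: Y l.
have eX t : eval_mx X t = \sum_(l < n) C l *m eval_mx (Y l) t.
  rewrite /X; elim/big_ind2: _ => // [|P p' Q q' <- <-|l _].
  - by apply/matrixP => i j; rewrite !mxE horner0.
  - exact: eval_mxD.
  - exact: eval_mx_mulC.
exists 1; split=> //; exists (eval_mx U), (eval_mx X); split.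
- apply: eval_mx_trajectory.
  (* Both sides are sums of a l + b l, shifted by one index; a n = 0 and
     a 0 + b 0 = 0 take care of the ends. *)
  pose a l := map_mx polyC A *m (map_mx polyC (C l) *m Y l).
  pose b l := map_mx polyC B *m ((chi l)%:P *: Y l).
  have ab0 : a 0%N + b 0%N = 0.
    rewrite /a /b mulmxA -scalemxAr scalemxAl -map_mxM -map_mxZ -mulmxDl -map_mxD.
    by rewrite C0 map_mx0 mul0mx.
  have an : a n = 0 by rewrite /a Cn map_mx0 mul0mx mulmx0.
  have dX : map_mx (@deriv R) X = \sum_(l < n) (a l.+1 + b l.+1).
    rewrite /X; transitivity (\sum_(l < n) map_mx polyC (C l) *m Y l.+1).
      elim/big_ind2: _ => // [|P p' Q q' <- <-|l _].
      - by apply/matrixP => i j; rewrite !mxE deriv0.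
      - by apply/matrixP => i j; rewrite !mxE derivD.
      - rewrite -dY; apply/matrixP => i j; rewrite !mxE raddf_sum.
        by apply: eq_bigr => k _; rewrite !mxE /= deriv_mulC mul_polyC.
    apply: eq_bigr => l _; rewrite /a /b CS // map_mxD map_mxM map_mxZ mulmxDl.
    by rewrite -mulmxA -scalemxAr scalemxAl.
  have sa : \sum_(l < n) a l = a 0%N + \sum_(l < n) a l.+1.
    by rewrite -[RHS](big_ord_recl n a) [RHS]big_ord_recr /= an addr0.
  rewrite dX big_split /= /X /U !mulmx_sumr [X in _ = X + _]sa [X in _ = _ + X]big_ord_recl.
  by rewrite addrACA [a _ + _]ab0 add0r.
- rewrite eX e0; apply: eq_bigr => l _; congr (_ *m _).
  by apply/colP => j; rewrite !mxE (yE l j).1.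
- rewrite eX e1; apply: eq_bigr => l _; congr (_ *m _).
  by apply/colP => j; rewrite !mxE (yE l j).2.
Qed.

End Flat.

(** * The objective function and controllability *)

Lemma col_restrict_mulmx (F : fieldType) l m n (W : 'M[F]_(l, m)) (M : 'M[F]_(m, n))
    (S : {set 'I_n}) : col_restrict (W *m M) S = W *m col_restrict M S.
Proof. by apply/matrixP => i j; rewrite !mxE; apply: eq_bigr => k _; rewrite mxE. Qed.

Lemma mul_cplx_id_cols (R : realType) l n (V : 'M[R[i]]_(l, n)) (S : {set 'I_n}) :
  V *m cplx_mx (id_cols R S) = col_restrict V S.
Proof.
rewrite (_ : cplx_mx _ = col_restrict 1%:M S) -?col_restrict_mulmx ?mulmx1 //.
by apply/matrixP => i j; rewrite !mxE rmorph_nat.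
Qed.

Section Actuation.
Context {R : realType} {n : nat} (A : 'M[R]_n) {p : nat} (lam : 'I_p -> R[i]).
Context (X : forall i, 'M[R[i]]_(n, geom_mult A (lam i))) (dataX : eigen_data X).

Definition total_row_rank (S : {set 'I_n}) : nat :=
  (\sum_(i < p) row_rank (X i) S)%N.

Lemma act_fun_row_rank : act_fun X = fun S => (total_row_rank S)%:R.
Proof.
have [_ _ nullX] := dataX; apply/funext => S.
rewrite /act_fun /total_row_rank natr_sum; apply: eq_bigr => i _.
by rewrite max_basis_columns //; have [] := nullX i.
Qed.

Lemma total_row_rank0 : total_row_rank finset.set0 = 0%N.
Proof. by apply: big1 => i _; apply: row_rank0. Qed.

Lemma total_row_rankS (S T : {set 'I_n}) :
  S \subset T -> (total_row_rank S <= total_row_rank T)%N.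
Proof. by move=> sST; apply: leq_sum => i _; apply: row_rankS. Qed.

Lemma total_row_rank_submod (S T : {set 'I_n}) s : S \subset T -> s \notin T ->
  (total_row_rank (s |: T) + total_row_rank S
    <= total_row_rank (s |: S) + total_row_rank T)%N.
Proof.
move=> sST sT; rewrite -!big_split /=.
by apply: leq_sum => i _; apply: row_rank_submod.
Qed.

Lemma act_fun_submodular : submodular (act_fun X).
Proof.
move=> S T s sST sT; rewrite act_fun_row_rank.
by rewrite lerBlDr addrAC lerBrDr -!natrD ler_nat total_row_rank_submod.
Qed.

Lemma total_row_rank_maxP (S : {set 'I_n}) :
  total_row_rank S = (\sum_(i < p) geom_mult A (lam i))%N <->
  forall i, row_free (col_restrict (X i)^T S).
Proof.
split=> [eqS i|freeS]; last first.
  by apply: eq_bigr => i _; rewrite -rank_col_restrict; apply/eqP/freeS.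
have le_i j := row_rank_le_width (X j) S.
have [_] := leqif_sum (fun j (_ : true) => leqif_eq (le_i j)).
rewrite [X in X == _]eqS eqxx => /esym/forallP/(_ i) /=.
by rewrite -rank_col_restrict.
Qed.

Lemma total_row_rankT :
  total_row_rank finset.setT = (\sum_(i < p) geom_mult A (lam i))%N.
Proof.
have [_ _ nullX] := dataX.
apply: eq_bigr => i _; rewrite row_rankT -mxrank_tr.
by apply/eqP; have [] := nullX i.
Qed.

Lemma left_eigenvectorE i (v : 'rV_n) :
  v *m cplx_mx A = lam i *: v <-> (v <= (X i)^T)%MS.
Proof.
have [_ _ nullX] := dataX; have [_ /eqmxP ->] := nullX i.
split=> [vA|/sub_kermxP].
  by apply/sub_kermxP; rewrite mulmxBr mul_mx_scalar vA subrr.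
by rewrite mulmxBr mul_mx_scalar => /eqP; rewrite subr_eq0 => /eqP.
Qed.

(** A left eigenvector at lam i is w X_i^T, and it meets the columns of I_S in
    w (X_iS)^T. *)
Lemma pbh_id_cols (S : {set 'I_n}) :
  (forall i, row_free (col_restrict (X i)^T S)) -> pbh A (id_cols R S).
Proof.
have [_ spec _] := dataX; move=> freeS z v vA vS.
apply/eqP/negPn/negP => v0.
have [|i eqz] := (spec z).1; first by apply/eigenvalueP; exists v.
move: vA; rewrite -eqz => /left_eigenvectorE/submxP[w ev].
suff w0 : w = 0 by move: v0; rewrite ev w0 mul0mx eqxx.
apply: (row_free_inj (freeS i)); rewrite mul0mx -vS ev.
by rewrite mul_cplx_id_cols col_restrict_mulmx.
Qed.

(** Only the entries of a row vector v at the nonzero rows of B matter for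
    v B, so a combination of the rows of X_i^T that vanishes there is killed by
    B. *)
Lemma pbh_support (m : nat) (B : 'M[R]_(n, m)) : pbh A B ->
  forall i, row_free (col_restrict (X i)^T [set j | row j B != 0]).
Proof.
have [_ _ nullX] := dataX; move=> AB i.
rewrite -kermx_eq0; apply/rowV0P => w /sub_kermxP; rewrite -col_restrict_mulmx => wS.
apply: (row_free_inj (nullX i).1); rewrite mul0mx.
apply: AB; first by apply/left_eigenvectorE/submxMl.
apply/rowP => j; rewrite !mxE big1 // => k _.
have [/rowP/(_ j)|kB] := eqVneq (row k B) 0.
  by rewrite !mxE => ->; rewrite mulr0.
have kS : k \in [set j | row j B != 0]%SET by rewrite inE.
move/rowP: wS => /(_ (enum_rank_in kS k)).
by rewrite !mxE enum_rankK_in // => ->; rewrite mul0r.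
Qed.

(** Eigenspaces of distinct eigenvalues are in direct sum. *)
Lemma sum_geom_mult_le : (\sum_(i < p) geom_mult A (lam i) <= n)%N.
Proof.
have [inj_lam _ _] := dataX.
have gE i : geom_mult A (lam i) = \rank (eigenspace (cplx_mx A) (lam i)).
  by rewrite mxrank_ker /geom_mult -mxrank_opp opprB.
under eq_bigr do rewrite gE.
have : mxdirect (\sum_(i < p) eigenspace (cplx_mx A) (lam i)).
  by apply: mxdirect_sum_eigenspace => i j _ _; apply: inj_lam.
by rewrite mxdirectE /= => /eqP <-; apply: rank_leq_col.
Qed.

End Actuation.

(** * Approximation ratios *)

Lemma macp_optimum_exists (R : realType) n (A : 'M[R]_n) :
  exists2 k, macp_optimum A k & exists2 B : 'M[R]_n, pbh A B & nonzero_rows B = k.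
Proof.
pose P k := `[< exists2 B : 'M[R]_n, controllable A B & nonzero_rows B = k >].
have exP : exists k, P k.
  exists (nonzero_rows (1%:M : 'M[R]_n)); apply/asboolP; exists 1%:M => //.
  by apply: pbh_controllable => z v _; rewrite /cplx_mx map_mx1 mulmx1.
have [k /asboolP[B ctrB rB] mink] := ex_minnP exP.
exists k; last by exists B => //; apply: controllable_pbh.
split=> [|B' ctrB']; first by exists B.
by apply: mink; apply/asboolP; exists B'.
Qed.

Section Approximation.
Context {R : realType} {n : nat} (A : 'M[R]_n) {p : nat} (lam : 'I_p -> R[i]).
Context (X : forall i, 'M[R[i]]_(n, geom_mult A (lam i))) (dataX : eigen_data X).
Let K := (\sum_(i < p) geom_mult A (lam i))%N.
Let g := total_row_rank X.
Let gT : g finset.setT = K := total_row_rankT dataX.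
Let g0 : g finset.set0 = 0%N := total_row_rank0 X.
Let gS := @total_row_rankS _ _ _ _ _ X.
Let g_submod := @total_row_rank_submod _ _ _ _ _ X.

(** The translation to set cover: an output S of the algorithm passes the
    eigenvector test because f(S) is maximal, and an optimal B passes it too,
    so that f is maximal at the set C of its nonzero rows. *)
Lemma greedy_achieves_of_cover (alpha : R) :
  (forall C S : {set 'I_n}, g C = g finset.setT ->
     greedy_state (fun S => (g S)%:R : R) (g finset.setT)%:R S ->
     g S = g finset.setT -> #|S|%:R <= alpha * #|C|%:R) ->
  greedy_achieves A (act_fun X) K%:R alpha.
Proof.
move=> bound; rewrite (act_fun_row_rank dataX) -gT.
split=> [|S [stS]]; first exact: greedy_never_stuck_nat.
rewrite ler_nat => gS_ge.
have gSK : g S = g finset.setT.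
  by apply/eqP; rewrite eqn_leq gS_ge gS // finset.subsetT.
split.
  apply/pbh_controllable/(pbh_id_cols dataX)/total_row_rank_maxP.
  by rewrite -/(g S) gSK gT.
have [k optk [B pbhB rB]] := macp_optimum_exists A.
exists k => //; rewrite -rB; apply: bound => //; rewrite gT.
exact/total_row_rank_maxP/pbh_support.
Qed.

Lemma greedy_harmonic_bound (C S : {set 'I_n}) : g C = g finset.setT ->
  greedy_state (fun S => (g S)%:R : R) (g finset.setT)%:R S ->
  g S = g finset.setT -> #|S|%:R <= harmonic_number K * #|C|%:R :> R.
Proof.
move=> gC stS gSK.
have : #|S|%:R + #|C|%:R * harmonic_number (g finset.setT - g S)
    <= #|C|%:R * harmonic_number (g finset.setT) :> R.
  exact: (greedy_card_harmonic g0 gS g_submod gC stS).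
by rewrite gSK subnn [harmonic_number 0]big_ord0 mulr0 addr0 gT mulrC.
Qed.

Lemma greedy_achieves_1ln m : (K <= m)%N ->
  greedy_achieves A (act_fun X) K%:R (1 + ln m%:R).
Proof.
move=> Km; apply: greedy_achieves_of_cover => C S gC stS gSK.
apply: le_trans (greedy_harmonic_bound gC stS gSK) _.
by rewrite ler_wpM2r // harmonic_number_le1lnn.
Qed.

(** An optimal set with one element is found exactly; otherwise the harmonic
    bound is sharp enough for K > 4, and for K <= 4 the trivial bound #|S| <= K
    is. *)
Lemma greedy_achieves_log2 : (1 < K)%N ->
  greedy_achieves A (act_fun X) K%:R (ln K%:R / ln 2).
Proof.
move=> K1; apply: greedy_achieves_of_cover => C S gC stS gSK.
have l2 := @ln2_gt0 R.
have log1 : 1 <= ln K%:R / ln 2 :> R.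
  by rewrite ler_pdivlMr // mul1r ler_ln ?posrE ?ltr0n ?ler_nat // ltnW.
have [C1|C1] := leqP #|C| 1.
  have S1 := greedy_cover1 g0 gS g_submod gC C1 stS.
  have Cpos : #|C| = 1%N.
    apply/eqP; rewrite eqn_leq C1 lt0n finset.cards_eq0; apply/eqP => C0.
    by move: K1; rewrite -gT -gC C0 g0.
  by rewrite Cpos mulr1; apply: le_trans log1; rewrite (ler_nat _ _ 1).
have [K4|K4] := leqP K 4; last first.
  apply: le_trans (greedy_harmonic_bound gC stS gSK) _.
  by rewrite ler_wpM2r // harmonic_number_le_log2.
have cS := greedy_card_le g0 gS g_submod stS.
apply: (@le_trans _ _ K%:R); first by rewrite ler_nat -gT -gSK.
apply: le_trans (@double_log2_ge R K _) _; first by rewrite K1.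
by rewrite mulrC ler_wpM2l ?ler_nat // (le_trans _ log1).
Qed.

End Approximation.

Lemma bigO_1ln (R : realType) :
  (fun n : nat => 1 + ln n%:R : R) =O_\oo (fun n : nat => ln n%:R : R).
Proof.
apply/eqO_exP; have l2 := @ln2_gt0 R.
have c0 : 0 < 1 + (ln 2)^-1 :> R by rewrite addr_gt0 ?invr_gt0.
exists (1 + (ln 2)^-1) => //; near=> m.
have m2 : (1 < m)%N by near: m; exact: nbhs_infty_ge.
have lm : ln 2 <= ln m%:R :> R.
  by rewrite ler_ln ?posrE ?ltr0n ?ler_nat // ltnW.
rewrite !ger0_norm ?addr_ge0 ?(le_trans (ltW l2) lm) //.
by rewrite mulrDl mul1r addrC lerD2l mulrC ler_pdivlMr // mul1r.
Unshelve. all: by end_near. Qed.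

Theorem theorem5 (R : realType) :
  (forall (n : nat) (A : 'M[R]_n) (p : nat) (lam : 'I_p -> R[i])
      (X : forall i, 'M[R[i]]_(n, geom_mult A (lam i))),
    eigen_data X -> submodular (act_fun X))
  /\
  (exists alpha : nat -> R,
    alpha =O_\oo (fun n : nat => ln n%:R : R) /\
    forall (n : nat) (A : 'M[R]_n) (p : nat) (lam : 'I_p -> R[i])
      (X : forall i, 'M[R[i]]_(n, geom_mult A (lam i))),
    eigen_data X ->
    greedy_achieves A (act_fun X)
      (\sum_(i < p) geom_mult A (lam i))%:R (alpha n))
  /\
  (forall (n : nat) (A : 'M[R]_n) (p : nat) (lam : 'I_p -> R[i])
      (X : forall i, 'M[R[i]]_(n, geom_mult A (lam i))),
    eigen_data X ->
    let K := (\sum_(i < p) geom_mult A (lam i))%N in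
    greedy_achieves A (act_fun X) K%:R (1 + ln K%:R) /\
    ((1 < K)%N ->
       greedy_achieves A (act_fun X) K%:R (ln K%:R / ln 2))).
Proof.
split; first by move=> n A p lam X; apply: act_fun_submodular.
split; last first.
  move=> n A p lam X dataX K; split; first exact: greedy_achieves_1ln.
  exact: greedy_achieves_log2.
exists (fun n => 1 + ln n%:R); split; first exact: bigO_1ln.
by move=> n A p lam X dataX; apply: greedy_achieves_1ln (sum_geom_mult_le dataX).
Qed.
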